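(* Let $$G(q)=\sum_{k=0}^\infty\frac{q^{k^2}}{(1-q)(1-q^2)\cdots(1-q^k)},\qquad H(q)=\sum_{k=0}^\infty\frac{q^{k(k+1)}}{(1-q)(1-q^2)\cdots(1-q^k)},\qquad F(q)=\prod_{j=0}^\infty\frac{1-q^{8j+8}}{1-q^{2j+2}},$$ regarded as formal power series in $\mathbb{C}[[q]]$. The system of identities $$g(q)+g(-q)=2F(q)\,g(q^{16}),\qquad g(q)-g(-q)=2q\,F(q)\,h(-q^4),$$ $$h(q)+h(-q)=2F(q)\,g(-q^4),\qquad h(q)-h(-q)=2q^3F(q)\,h(q^{16})$$ determines the pair $(G,H)$ uniquely up to normalization. That is, if $g,h\in\mathbb{C}[[q]]$ satisfy these four identities, then there is a constant $c\in\mathbb{C}$ such that $g=c\,G$ and $h=c\,H$. In particular, if in addition $g(0)=h(0)=1$, then $g=G$ and $h=H$.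
   Context: All series and products are formal power series in the indeterminate $q$ (empty products equal $1$). For a formal power series $f(q)=\sum_{n\ge 0}f_nq^n$, the notations $f(-q)$, $f(-q^4)$, $f(q^{16})$ denote the series obtained by substitution, and $f(0)=f_0$ is the constant term. *)

(* Defs.v *)
From HB Require Import structures.
From mathcomp Require Import all_boot all_order all_algebra.
From mathcomp Require Import boolp classical_sets reals.
From mathcomp Require Export complex.

Set Implicit Arguments.
Unset Strict Implicit.
Unset Printing Implicit Defensive.

Import GRing.Theory.
Local Open Scope ring_scope.

(* A record rather than [nat -> K], so that the pointwise ring structure on    *)
(* functions can never be inferred in place of the Cauchy product.             *)
Record fps (K : Type) := FPS { fps_coef :> nat -> K }.

Section FpsRing.
Variable K : fieldType.
Implicit Types f g h : fps K.

HB.instance Definition _ := gen_eqMixin (fps K).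
HB.instance Definition _ := gen_choiceMixin (fps K).

Lemma fpsP f g : f =1 g -> f = g.
Proof. by case: f g => [f] [g] /= /funext ->. Qed.

Definition fps_zero : fps K := FPS (fun=> 0).
Definition fps_opp f : fps K := FPS (fun n => - f n).
Definition fps_add f g : fps K := FPS (fun n => f n + g n).

Fact fps_addA : associative fps_add.
Proof. by move=> f g h; apply: fpsP => n /=; rewrite addrA. Qed.
Fact fps_addC : commutative fps_add.
Proof. by move=> f g; apply: fpsP => n /=; rewrite addrC. Qed.
Fact fps_add0 : left_id fps_zero fps_add.
Proof. by move=> f; apply: fpsP => n /=; rewrite add0r. Qed.
Fact fps_addN : left_inverse fps_zero fps_opp fps_add.
Proof. by move=> f; apply: fpsP => n /=; rewrite addNr. Qed.

HB.instance Definition _ :=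
  GRing.isZmodule.Build (fps K) fps_addA fps_addC fps_add0 fps_addN.

Definition fps_one : fps K := FPS (fun n => (n == 0%N)%:R).
Definition fps_mul f g : fps K :=
  FPS (fun n => \sum_(i < n.+1) f i * g (n - i)%N).

Definition fps_trunc m f : {poly K} := \poly_(i < m) f i.

Lemma fps_mul_trunc m f g n : (n < m)%N ->
  fps_mul f g n = (fps_trunc m f * fps_trunc m g)`_n.
Proof.
move=> ltnm; rewrite coefM; apply: eq_bigr => i _; rewrite !coef_poly.
have -> : (i < m)%N by apply: leq_ltn_trans ltnm; rewrite -ltnS.
by rewrite (leq_ltn_trans (leq_subr _ _) ltnm).
Qed.

Lemma coef_mul_trunc m (p p' r : {poly K}) n :
    (forall k, (k < m)%N -> p`_k = p'`_k) -> (n < m)%N ->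
  (p * r)`_n = (p' * r)`_n.
Proof.
move=> eqp ltnm; rewrite !coefM; apply: eq_bigr => i _; rewrite eqp //.
by apply: leq_ltn_trans ltnm; rewrite -ltnS.
Qed.

Fact fps_mulC : commutative fps_mul.
Proof.
by move=> f g; apply: fpsP => n; rewrite !(@fps_mul_trunc n.+1) // mulrC.
Qed.

Fact fps_mulA : associative fps_mul.
Proof.
move=> f g h; apply: fpsP => n; rewrite !(@fps_mul_trunc n.+1) // [in LHS]mulrC.
have truncM f1 f2 k : (k < n.+1)%N ->
    (fps_trunc n.+1 (fps_mul f1 f2))`_k =
    (fps_trunc n.+1 f1 * fps_trunc n.+1 f2)`_k.
  by move=> lekn; rewrite coef_poly lekn (fps_mul_trunc _ _ lekn).
rewrite (coef_mul_trunc _ (truncM g h)) // (coef_mul_trunc _ (truncM f g)) //.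
by rewrite [in LHS]mulrC mulrA.
Qed.

Fact fps_mul1 : left_id fps_one fps_mul.
Proof.
move=> f; apply: fpsP => n /=; rewrite big_ord_recl /= mul1r subn0 big1 ?addr0//.
by move=> i _; rewrite mul0r.
Qed.

Fact fps_mulDl : left_distributive fps_mul fps_add.
Proof.
move=> f g h; apply: fpsP => n /=; rewrite -big_split /=.
by apply: eq_bigr => i _; rewrite mulrDl.
Qed.

Fact fps_oner_neq0 : fps_one != 0.
Proof.
apply/eqP => /(congr1 (fun f : fps K => f 0%N)) /= /eqP.
by rewrite oner_eq0.
Qed.

HB.instance Definition _ := GRing.Zmodule_isComNzRing.Build (fps K)
  fps_mulA fps_mulC fps_mul1 fps_mulDl fps_oner_neq0.

Definition fps_scale (c : K) f : fps K := FPS (fun n => c * f n).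

Fact fps_scaleA a b f : fps_scale a (fps_scale b f) = fps_scale (a * b) f.
Proof. by apply: fpsP => n /=; rewrite mulrA. Qed.
Fact fps_scale1 : left_id 1 fps_scale.
Proof. by move=> f; apply: fpsP => n /=; rewrite mul1r. Qed.
Fact fps_scaleDr : right_distributive fps_scale +%R.
Proof. by move=> c f g; apply: fpsP => n /=; rewrite mulrDr. Qed.
Fact fps_scaleDl f : {morph fps_scale^~ f : a b / a + b}.
Proof. by move=> a b; apply: fpsP => n /=; rewrite mulrDl. Qed.

HB.instance Definition _ := GRing.Zmodule_isLmodule.Build K (fps K)
  fps_scaleA fps_scale1 fps_scaleDr fps_scaleDl.

Fact fps_scaleAl (c : K) f g : c *: (f * g) = (c *: f) * g.
Proof.
apply: fpsP => n /=; rewrite mulr_sumr.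
by apply: eq_bigr => i _; rewrite mulrA.
Qed.

HB.instance Definition _ :=
  GRing.Lmodule_isLalgebra.Build K (fps K) fps_scaleAl.
HB.instance Definition _ := GRing.Lalgebra_isComAlgebra.Build K (fps K).

(* The list of the first n coefficients of the inverse of f, in order.         *)
Fixpoint fps_inv_seq f n : seq K :=
  if n is m.+1 then
    let s := fps_inv_seq f m in
    rcons s ((f 0%N)^-1 *
             ((m == 0%N)%:R - \sum_(i < m) f (m - i)%N * nth 0 s i))
  else [::].

(* Outside the units the inverse is the identity, as ssralg requires.          *)
Definition fps_unit : pred (fps K) := fun f => f 0%N != 0.
Definition fps_inv f : fps K :=
  if f 0%N != 0 then FPS (fun n => nth 0 (fps_inv_seq f n.+1) n) else f.

Lemma size_fps_inv_seq f n : size (fps_inv_seq f n) = n.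
Proof. by elim: n => //= n IHn; rewrite size_rcons IHn. Qed.

Lemma nth_fps_inv_seq f m n : (m < n)%N ->
  nth 0 (fps_inv_seq f n) m = nth 0 (fps_inv_seq f m.+1) m.
Proof.
elim: n => // n IHn; rewrite ltnS leq_eqVlt => /predU1P[-> // | ltmn].
by rewrite {1}/fps_inv_seq -/fps_inv_seq nth_rcons size_fps_inv_seq ltmn IHn.
Qed.

Fact fps_mulVr : {in fps_unit, left_inverse 1 fps_inv *%R}.
Proof.
move=> f f0; have {}f0 : f 0%N != 0 by [].
apply: fpsP => n; rewrite /fps_inv f0.
rewrite [LHS]/= big_ord_recr subnn /=.
rewrite nth_rcons size_fps_inv_seq ltnn eqxx mulrAC mulVf // mul1r addrC.
rewrite [X in _ - _ + X](eq_bigr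
  (fun i : 'I_n => f (n - i)%N * nth 0 (fps_inv_seq f n) i)).
  by rewrite subrK.
by move=> i _; rewrite -[LHS]/(nth 0 (fps_inv_seq f i.+1) i * _)
  -(nth_fps_inv_seq _ (ltn_ord i)) mulrC.
Qed.

Fact fps_unitPl f g : g * f = 1 -> fps_unit f.
Proof.
move=> /(congr1 (fun h : fps K => h 0%N)); rewrite /= big_ord1 /= => gf1.
by apply: contra_eq_neq gf1 => ->; rewrite mulr0 eq_sym oner_neq0.
Qed.

Fact fps_inv_out : {in [predC fps_unit], fps_inv =1 id}.
Proof.
move=> f; rewrite inE /= => nf; rewrite /fps_inv.
by case: ifP => // f0; case/negP: nf.
Qed.

HB.instance Definition _ := GRing.ComNzRing_hasMulInverse.Build (fps K)
  fps_mulVr fps_unitPl fps_inv_out.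

Definition fps_X : fps K := FPS (fun n => (n == 1%N)%:R).

(* Convergence in the q-adic topology: each coefficient is eventually constant.*)
Definition fps_cvg (u : nat -> fps K) f : Prop :=
  forall n, exists N, forall m, (N <= m)%N -> u m n = f n.

Definition fps_lim (u : nat -> fps K) : fps K :=
  xget 0 [set f | fps_cvg u f]%classic.

Definition fps_series (u : nat -> fps K) : fps K :=
  fps_lim (fun m => \sum_(k < m) u k).

Definition fps_infprod (u : nat -> fps K) : fps K :=
  fps_lim (fun m => \prod_(j < m) u j).

(* The substitution f(g(q)); meaningful when g has zero constant term.         *)
Definition fps_comp f g : fps K := fps_series (fun k => f k *: g ^+ k).

Lemma fps_cvg_lim u f : fps_cvg u f -> fps_lim u = f.
Proof.
move=> uf; have := xgetI (0 : fps K) uf; rewrite -/(fps_lim u) => ul.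
apply: fpsP => n; have [[M Mf] [N Nl]] := (uf n, ul n).
by rewrite -(Mf _ (leq_maxl M N)) -(Nl _ (leq_maxr M N)).
Qed.

End FpsRing.

Arguments fps_X {K}.
Notation "f \oq g" := (fps_comp f g)
  (at level 30, right associativity) : ring_scope.

Section RogersRamanujan.
Variable K : fieldType.
Local Notation q := (@fps_X K).

Definition RR_G : fps K :=
  fps_series (fun k => q ^+ (k ^ 2) / \prod_(1 <= i < k.+1) (1 - q ^+ i)).

Definition RR_H : fps K :=
  fps_series (fun k => q ^+ (k * k.+1) / \prod_(1 <= i < k.+1) (1 - q ^+ i)).

Definition RR_F : fps K :=
  fps_infprod (fun j => (1 - q ^+ (8 * j + 8)) / (1 - q ^+ (2 * j + 2))).

Definition RR_system (g h : fps K) : Prop :=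
  [/\ g + g \oq (- q) = 2 * RR_F * g \oq (q ^+ 16),
      g - g \oq (- q) = 2 * q * RR_F * h \oq (- q ^+ 4),
      h + h \oq (- q) = 2 * RR_F * g \oq (- q ^+ 4)
    & h - h \oq (- q) = 2 * q ^+ 3 * RR_F * h \oq (q ^+ 16)].

End RogersRamanujan.

Arguments RR_G {K}.
Arguments RR_H {K}.
Arguments RR_F {K}.

(* Main.v *)
Require Import Defs.
From mathcomp Require Import all_boot all_order all_algebra reals.
From mathcomp Require Import boolp ring zify.
Import GRing.Theory.
Local Open Scope ring_scope.
Set Implicit Arguments.
Unset Strict Implicit.
Unset Printing Implicit Defensive.

(* Write G(x), H(x) for the two series at an arbitrary x without constant      *)
(* term.  Expanding (-t x; x^2)_oo by Euler's identity and summing along the   *)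
(* antidiagonals gives, for all s and t,                                       *)
(*   (-t x; x^2)_oo * sum_n x^(n^2) s^n / ((x^2; x^2)_n (-t x; x^2)_n)         *)
(*     = sum_N x^(N^2) W_N(s, t),                                              *)
(* where W_N(s, t) is the coefficient of z^N in 1/((s z, t z; x^2)_oo).  This  *)
(* coefficient is explicit in two cases: W_N(1, x) = 1/(x; x)_N, and W_N(1, -1)*)
(* is 0 for odd N and 1/(x^4; x^4)_(N/2) for even N.                           *)
(* The pairs (s, t) = (1, x), (x^2, x) turn G(x) and H(x) into                 *)
(* (-x^2; x^2)_oo times sums with denominators (x^4; x^4)_n.  With y = x^4,    *)
(* the even and odd terms of these sums are the series with denominators       *)
(* (y; y)_(2n) and (y; y)_(2n+1) that the pairs (1, -1), (y, -y^2), (y, -1),   *)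
(* (y^2, -y^2) in base y evaluate to (-y; y)_oo times G(y^4), H(-y), G(-y),    *)
(* H(y^4).  Hence                                                              *)
(*   G(x) = (-x^2; x^2)_oo (-x^4; x^4)_oo (G(x^16) + x H(-x^4)),               *)
(*   H(x) = (-x^2; x^2)_oo (-x^4; x^4)_oo (G(-x^4) + x^3 H(x^16)),             *)
(* and x = q, -q give the system.                                              *)
(* Conversely the system expresses g and h through themselves at q^16 and      *)
(* -q^4, so that a solution with g(0) = 0 vanishes to every order.             *)

(** * Congruences modulo powers of q *)

(** Existence rests on [transform], which turns a sum with denominators (x^2; x^2)_n (-t x; x^2)_n
    into one whose terms are W_N, here [qexp_conv]. The three-term recurrence [qexp_convSS]
    evaluates W_N in the two explicit cases, [qexp_conv_sqrt] and [qexp_conv_opp]. Base x then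
    yields [rrG_quartic] and [rrH_quartic], base x^4 yields the four [slater] lemmas, and splitting
    by parity combines them into [rrG_dissection] and [rrH_dissection]. Uniqueness is a contraction
    argument on the linear system of [RR_system_halved]: q^16 and -q^4 vanish to order at least 2,
    so substituting them raises the order of vanishing ([fps_comp_eqm0]), and a solution with zero
    constant terms is zero. All limits are handled through congruences modulo q^M, where series and
    products become finite ([seriesE], [infprodE]). *)

Section Congruence.
Variable K : fieldType.
Implicit Types f g h r x : fps K.

Record eqm (M : nat) f g : Prop :=
  Eqm { eqm_coef :> forall n, (n < M)%N -> f n = g n }.

Lemma eqm_refl M f : eqm M f f. Proof. by []. Qed.

Lemma eqm_sym M f g : eqm M f g -> eqm M g f.
Proof. by case=> e; split=> n /e. Qed.

Lemma eqm_trans M g f h : eqm M f g -> eqm M g h -> eqm M f h.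
Proof. by move=> [e1] [e2]; split=> n ltn; rewrite e1 // e2. Qed.

Lemma eqm_leq N M f g : eqm N f g -> (M <= N)%N -> eqm M f g.
Proof. by move=> [e] leMN; split=> n ltn; apply: e; apply: leq_trans leMN. Qed.

Lemma eqmP f g : (forall M, eqm M f g) -> f = g.
Proof. by move=> e; apply: fpsP => n; apply: (e n.+1). Qed.

Lemma eqmD M f f' g g' : eqm M f f' -> eqm M g g' -> eqm M (f + g) (f' + g').
Proof. by move=> [ef] [eg]; split=> n ltn /=; rewrite ef ?eg. Qed.

Lemma eqmM M f f' g g' : eqm M f f' -> eqm M g g' -> eqm M (f * g) (f' * g').
Proof.
move=> [ef] [eg]; split=> n ltn; apply: eq_bigr => i _.
by rewrite ef ?eg // (leq_ltn_trans _ ltn) ?leq_subr // -ltnS.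
Qed.

Lemma eqmZ M c f f' : eqm M f f' -> eqm M (c *: f) (c *: f').
Proof. by move=> [ef]; split=> n ltn /=; rewrite ef. Qed.

Lemma eqm_sum M (I : Type) (s : seq I) (P : pred I) (u v : I -> fps K) :
  (forall i, P i -> eqm M (u i) (v i)) ->
  eqm M (\sum_(i <- s | P i) u i) (\sum_(i <- s | P i) v i).
Proof. by move=> e; elim/big_ind2: _ => // *; apply: eqmD. Qed.

Lemma eqm_sum0 M (I : Type) (s : seq I) (P : pred I) (u : I -> fps K) :
  (forall i, P i -> eqm M (u i) 0) -> eqm M (\sum_(i <- s | P i) u i) 0.
Proof. by move=> e; split=> n ltn; rewrite (eqm_coef (eqm_sum s e)) // big1. Qed.

Lemma eqm_prod1 M (I : Type) (s : seq I) (P : pred I) (u : I -> fps K) :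
  (forall i, P i -> eqm M (u i) 1) -> eqm M (\prod_(i <- s | P i) u i) 1.
Proof.
move=> e; elim/big_ind: _ => // a b ea eb.
by rewrite -[X in eqm _ _ X]mulr1; apply: eqmM.
Qed.

Lemma eqm0M a b f g : eqm a f 0 -> eqm b g 0 -> eqm (a + b) (f * g) 0.
Proof.
move=> [ef] [eg]; split=> n ltn /=; rewrite big1 // => i _.
have [lti|lei] := ltnP i a; first by rewrite ef ?mul0r.
by rewrite [g _]eg ?mulr0 //; have := ltn_ord i; lia.
Qed.

Lemma eqm0Ml M f g : eqm M f 0 -> eqm M (f * g) 0.
Proof. by move=> e; rewrite -[M]addn0; apply: eqm0M. Qed.

Lemma eqm0Mr M f g : eqm M g 0 -> eqm M (f * g) 0.
Proof. by rewrite mulrC; apply: eqm0Ml. Qed.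

Lemma eqm0X a f n : eqm a f 0 -> eqm (a * n) (f ^+ n) 0.
Proof.
by move=> e; elim: n => [|n IHn]; rewrite ?muln0 // mulnS exprS; apply: eqm0M.
Qed.

Lemma eqmX0 M f n : f 0%N = 0 -> (M <= n)%N -> eqm M (f ^+ n) 0.
Proof.
move=> f0 leMn; have f1 : eqm 1 f 0 by split=> -[].
by apply: eqm_leq (eqm0X n f1) _; rewrite mul1n.
Qed.

Lemma eqm_1D M f : eqm M f 0 -> eqm M (1 + f) 1.
Proof. by move=> [e]; split=> n ltn /=; rewrite e //= addr0. Qed.

Lemma fps_coef0M f g : (f * g) 0%N = f 0%N * g 0%N.
Proof. by rewrite /= big_ord1. Qed.

Lemma fps_coef0X f n : f 0%N = 0 -> (f ^+ n.+1) 0%N = 0.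
Proof. by move=> f0; rewrite exprS fps_coef0M f0 mul0r. Qed.


Lemma fps_coef0N f : f 0%N = 0 -> (- f) 0%N = 0.
Proof. by move=> /= ->; rewrite oppr0. Qed.

Lemma unit_1D f : f 0%N = 0 -> 1 + f \is a GRing.unit.
Proof.
move=> f0; change (is_true (1 + f 0%N != 0)).
by rewrite f0 addr0 oner_eq0.
Qed.

Lemma unit_1B f : f 0%N = 0 -> 1 - f \is a GRing.unit.
Proof. by move=> f0; apply: unit_1D; apply: fps_coef0N. Qed.

(** [fps_lim] chooses its value by [xget], so a limit has to be exhibited: the diagonal series,
    whose coefficient n is that of [u n.+1]. *)
Lemma fps_limP (u : nat -> fps K) :
  (forall M m, (M <= m)%N -> eqm M (u m) (u M)) ->
  forall M m, (M <= m)%N -> eqm M (fps_lim u) (u m).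
Proof.
move=> uC M m lem; split=> n ltn.
have cv : fps_cvg u (FPS (fun n => u n.+1 n)).
  by move=> k; exists k.+1 => j lej; apply: (eqm_coef (uC k.+1 j lej)).
rewrite (fps_cvg_lim cv) /=.
by rewrite -(eqm_coef (uC _ _ ltn)) // (eqm_coef (uC _ _ lem)).
Qed.

Lemma seriesE (u : nat -> fps K) : (forall n, eqm n (u n) 0) ->
  forall M m, (M <= m)%N -> eqm M (fps_series u) (\sum_(k < m) u k).
Proof.
move=> u0; apply: fps_limP => M m leMm.
rewrite -!(big_mkord xpredT) (big_cat_nat (leq0n _) leMm) /= -[X in eqm _ _ X]addr0.
apply: eqmD => //; rewrite big_nat_cond; apply: eqm_sum0 => i /andP[/andP[lei _] _].
exact: eqm_leq (u0 i) lei.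
Qed.

Lemma infprodE (u : nat -> fps K) : (forall n, eqm n (u n) 1) ->
  forall M m, (M <= m)%N -> eqm M (fps_infprod u) (\prod_(k < m) u k).
Proof.
move=> u1; apply: fps_limP => M m leMm.
rewrite -!(big_mkord xpredT) (big_cat_nat (leq0n _) leMm) /= -[X in eqm _ _ X]mulr1.
apply: eqmM => //; rewrite big_nat_cond; apply: eqm_prod1 => i /andP[/andP[lei _] _].
exact: eqm_leq (u1 i) lei.
Qed.

Lemma series_eq (u v : nat -> fps K) : u =1 v -> fps_series u = fps_series v.
Proof. by move=> /funext->. Qed.

Lemma infprod_eq (u v : nat -> fps K) : u =1 v -> fps_infprod u = fps_infprod v.
Proof. by move=> /funext->. Qed.

Lemma seriesMl f (u : nat -> fps K) : (forall n, eqm n (u n) 0) ->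
  f * fps_series u = fps_series (fun n => f * u n).
Proof.
move=> u0; apply: eqmP => M.
have fu0 n : eqm n (f * u n) 0 by apply: eqm0Mr.
apply: (eqm_trans _ (eqm_sym (seriesE fu0 (leqnn M)))).
by rewrite -mulr_sumr; apply: eqmM => //; apply: seriesE.
Qed.

Lemma series_even_odd (u : nat -> fps K) : (forall n, eqm n (u n) 0) ->
  fps_series u =
  fps_series (fun n => u n.*2) + fps_series (fun n => u n.*2.+1).
Proof.
move=> u0; apply: eqmP => M.
have ue n : eqm n (u n.*2) 0 by apply: eqm_leq (u0 _) _; lia.
have uo n : eqm n (u n.*2.+1) 0 by apply: eqm_leq (u0 _) _; lia.
have le : (M <= M.*2)%N by lia.
apply: (eqm_trans (seriesE u0 le)); apply: eqm_sym.
apply: (eqm_trans (eqmD (seriesE ue (leqnn M)) (seriesE uo (leqnn M)))).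
split=> n _; congr (fps_coef _ n); elim: M {le} => [|M IHM].
  by rewrite !big_ord0 addr0.
by rewrite doubleS !big_ord_recr /= -IHM addrACA -!addrA.
Qed.

Lemma infprod_split (u : nat -> fps K) m : (forall n, eqm n (u n) 1) ->
  fps_infprod u = \prod_(j < m) u j * fps_infprod (fun j => u (m + j)%N).
Proof.
move=> u1; apply: eqmP => M.
have um n : eqm n (u (m + n)%N) 1 by apply: eqm_leq (u1 _) _; lia.
have le : (M <= m + M)%N by lia.
apply: (eqm_trans (infprodE u1 le)); apply: eqm_sym.
apply: (eqm_trans (eqmM (@eqm_refl _ _) (infprodE um (leqnn M)))).
by rewrite big_split_ord.
Qed.

Lemma infprodM (u v : nat -> fps K) :
  (forall n, eqm n (u n) 1) -> (forall n, eqm n (v n) 1) ->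
  fps_infprod u * fps_infprod v = fps_infprod (fun j => u j * v j).
Proof.
move=> u1 v1; apply: eqmP => M.
have uv1 n : eqm n (u n * v n) 1.
  by rewrite -[X in eqm _ _ X]mulr1; apply: eqmM.
apply: (eqm_trans _ (eqm_sym (infprodE uv1 (leqnn M)))).
by rewrite big_split; apply: eqmM; apply: infprodE.
Qed.

(** Modulo q^M both sides reduce to the finite sum over the triangle n + m < M. *)
Lemma series_antidiagonal (c : nat -> nat -> fps K) :
  (forall n m, eqm (n + m) (c n m) 0) ->
  fps_series (fun n => fps_series (c n)) =
  fps_series (fun N => \sum_(n < N.+1) c n (N - n)%N).
Proof.
move=> c0; apply: eqmP => M.
have cn0 n m : eqm m (c n m) 0 by apply: eqm_leq (c0 n m) _; lia.
have s0 n : eqm n (fps_series (c n)) 0.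
  apply: (eqm_trans (seriesE (cn0 n) (leqnn n))); apply: eqm_sum0 => m _.
  by apply: eqm_leq (c0 n m) _; lia.
have a0 N : eqm N (\sum_(n < N.+1) c n (N - n)%N) 0.
  by apply: eqm_sum0 => n _; apply: eqm_leq (c0 _ _) _; have := ltn_ord n; lia.
apply: (eqm_trans (seriesE s0 (leqnn M))); apply: eqm_sym.
apply: (eqm_trans (seriesE a0 (leqnn M))); apply: eqm_sym.
have -> : \sum_(N < M) \sum_(n < N.+1) c n (N - n)%N =
          \sum_(n < M) \sum_(N < M | (n <= N)%N) c n (N - n)%N.
  rewrite (exchange_big_dep xpredT) //=; apply: eq_bigr => N _.
  by rewrite (big_ord_widen_cond M xpredT (fun n => c n (N - n)%N)).
apply: eqm_sum => n _.
have le : (M <= M - n + n)%N by have := ltn_ord n; lia.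
have -> : \sum_(N < M | (n <= N)%N) c n (N - n)%N = \sum_(m < M - n) c n m.
  rewrite -(big_mkord (fun N => (n <= N)%N) (fun N => c n (N - n)%N)).
  have leM : (n <= M)%N by apply: ltnW.
  rewrite (big_cat_nat (leq0n _) leM) /= [X in X + _]big_nat_cond big1 => [|i]; last lia.
  rewrite add0r -{1}[nat_of_ord n]add0n big_addn big_mkord.
  by apply: eq_big => [i|i _]; rewrite ?leq_addl ?addnK.
apply: (eqm_trans (seriesE (cn0 n) (leqnn M))).
rewrite -!(big_mkord xpredT (c n)).
have leM : (M - n <= M)%N by lia.
rewrite (big_cat_nat (leq0n _) leM) /= -[X in eqm _ _ X]addr0.
apply: eqmD => //; rewrite big_nat_cond; apply: eqm_sum0 => i /andP[/andP[lei _] _].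
by apply: eqm_leq (c0 _ _) _; lia.
Qed.

End Congruence.

(** * The transformation of q-series *)

Section QSeries.
Variable K : fieldType.
Implicit Types p s t x y : fps K.

Definition qpoch x n : fps K := \prod_(i < n) (1 - x ^+ i.+1).

Lemma qpoch0 x : qpoch x 0 = 1. Proof. exact: big_ord0. Qed.

Lemma qpochS x n : qpoch x n.+1 = qpoch x n * (1 - x ^+ n.+1).
Proof. exact: big_ord_recr. Qed.

Lemma unit_prod n (u : nat -> fps K) :
  (forall i, u i \is a GRing.unit) -> \prod_(i < n) u i \is a GRing.unit.
Proof.
move=> uu; elim/big_ind: _ => //; first exact: unitr1.
by move=> a b ua ub; rewrite unitrM ua.
Qed.

Lemma unit_qpoch x n : x 0%N = 0 -> qpoch x n \is a GRing.unit.
Proof. move=> x0; apply: (@unit_prod n (fun i => 1 - x ^+ i.+1)) => i.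
by apply/unit_1B/fps_coef0X. Qed.

Lemma invr_qpochS x n : x 0%N = 0 ->
  (1 - x ^+ n.+1) * (qpoch x n.+1)^-1 = (qpoch x n)^-1.
Proof.
move=> x0; have u1 : 1 - x ^+ n.+1 \is a GRing.unit by apply/unit_1B/fps_coef0X.
by rewrite qpochS invrM ?unit_qpoch // mulrA divrr // mul1r.
Qed.

(* The coefficients of z^n in 1/(s z; p)_oo, and of z^N in                     *)
(* 1/((s z; p)_oo (t z; p)_oo).                                                *)
Definition qexp p s n : fps K := s ^+ n / qpoch p n.
Definition qexp_conv p s t N : fps K :=
  \sum_(n < N.+1) qexp p s n * qexp p t (N - n)%N.

Lemma qexp0 p s : qexp p s 0 = 1.
Proof. by rewrite /qexp qpoch0 divr1. Qed.

Lemma qexpS p s n : p 0%N = 0 ->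
  (1 - p ^+ n.+1) * qexp p s n.+1 = s * qexp p s n.
Proof.
by move=> p0; rewrite /qexp mulrCA invr_qpochS // exprS mulrA.
Qed.

Lemma qexp_conv0 p s t : qexp_conv p s t 0 = 1.
Proof. by rewrite /qexp_conv big_ord1 !qexp0 mulr1. Qed.

Lemma qexp_conv_step p s t N : p 0%N = 0 ->
  \sum_(n < N.+2) (1 - p ^+ n) * qexp p s n * qexp p t (N.+1 - n)%N =
  s * qexp_conv p s t N.
Proof.
move=> p0; rewrite big_ord_recl expr0 subrr !mul0r add0r mulr_sumr.
by apply: eq_bigr => n _; rewrite qexpS // subSS mulrA.
Qed.

(** With E_s(z) = 1/(s z; p)_oo, this is the coefficient of z^N in E_s(p z) E_t(z). Since E_s(p z) =
    (1 - s z) E_s(z), it reduces to [qexp_conv]. *)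
Definition qexp_conv_twist p s t N : fps K :=
  \sum_(n < N.+1) p ^+ n * qexp p s n * qexp p t (N - n)%N.

Lemma qexp_conv_twistS p s t N : p 0%N = 0 ->
  qexp_conv_twist p s t N.+1 =
  qexp_conv p s t N.+1 - s * qexp_conv p s t N.
Proof.
move=> p0; rewrite -qexp_conv_step // -sumrB; apply: eq_bigr => n _.
by ring.
Qed.

(** For W(z) = E_s(z) E_t(z), write W(z) - W(p z) as (E_s(z) - E_s(p z)) E_t(z) + E_s(p z) (E_t(z) -
    E_t(p z)) and use E_s(z) - E_s(p z) = s z E_s(z), likewise for t. *)
Lemma qexp_convS p s t N : p 0%N = 0 ->
  (1 - p ^+ N.+1) * qexp_conv p s t N.+1 =
  s * qexp_conv p s t N + t * qexp_conv_twist p s t N.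
Proof.
move=> p0; rewrite -qexp_conv_step // [X in _ = _ + X]mulr_sumr.
have -> : \sum_(n < N.+1) t * (p ^+ n * qexp p s n * qexp p t (N - n)%N) =
  \sum_(n < N.+2) p ^+ n * qexp p s n *
    ((1 - p ^+ (N.+1 - n)) * qexp p t (N.+1 - n)%N).
  rewrite [RHS]big_ord_recr /= subnn expr0 subrr mul0r mulr0 addr0.
  apply: eq_bigr => n _; have len : (n <= N)%N by rewrite -ltnS.
  rewrite /= (subSn len) qexpS //.
  by ring.
rewrite mulr_sumr -big_split /=; apply: eq_bigr => n _.
have -> : p ^+ N.+1 = p ^+ n * p ^+ (N.+1 - n).
  by rewrite -exprD subnKC // -ltnS.
by ring.
Qed.

Lemma qexp_conv1 p s t : p 0%N = 0 ->
  (1 - p) * qexp_conv p s t 1 = s + t.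
Proof.
move=> p0; have /= := qexp_convS s t 0 p0.
by rewrite expr1 => ->; rewrite qexp_conv0 /qexp_conv_twist big_ord1 expr0
  !qexp0 !mulr1.
Qed.

(** Coefficient form of W(p z) = (1 - s z) (1 - t z) W(z). *)
Lemma qexp_convSS p s t N : p 0%N = 0 ->
  (1 - p ^+ N.+2) * qexp_conv p s t N.+2 =
  (s + t) * qexp_conv p s t N.+1 - s * t * qexp_conv p s t N.
Proof. by move=> p0; rewrite qexp_convS // qexp_conv_twistS //; ring. Qed.

Lemma qexp_conv_scale p a s t N :
  qexp_conv p (a * s) (a * t) N = a ^+ N * qexp_conv p s t N.
Proof.
rewrite /qexp_conv mulr_sumr; apply: eq_bigr => n _.
have -> : a ^+ N = a ^+ n * a ^+ (N - n) by rewrite -exprD subnKC // -ltnS.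
by rewrite /qexp !exprMn; ring.
Qed.

Lemma qexp_convC p s t N : qexp_conv p s t N = qexp_conv p t s N.
Proof.
rewrite /qexp_conv (reindex_inj rev_ord_inj) /=; apply: eq_bigr => n _.
by rewrite subSS subKn 1?mulrC // -ltnS.
Qed.

(** Reflects (z; x^2)_oo (x z; x^2)_oo = (z; x)_oo. The proof checks that 1/(x; x)_N satisfies the
    three-term recurrence, whence the induction on two consecutive values. *)
Lemma qexp_conv_sqrt x N : x 0%N = 0 ->
  qexp_conv (x ^+ 2) 1 x N = (qpoch x N)^-1.
Proof.
move=> x0; have p0 : (x ^+ 2) 0%N = 0 by apply: fps_coef0X.
suff [] : qexp_conv (x ^+ 2) 1 x N = (qpoch x N)^-1 /\
          qexp_conv (x ^+ 2) 1 x N.+1 = (qpoch x N.+1)^-1 by [].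
elim: N => [|N [IH1 IH2]]; split=> //.
- by rewrite qexp_conv0 qpoch0 invr1.
- have u : 1 - x ^+ 2 \is a GRing.unit by apply: unit_1B.
  apply: (mulrI u); rewrite qexp_conv1 //.
  have -> : 1 - x ^+ 2 = (1 + x) * (1 - x ^+ 1) by ring.
  by rewrite -mulrA invr_qpochS // qpoch0 invr1 mulr1.
have u : 1 - (x ^+ 2) ^+ N.+2 \is a GRing.unit by apply/unit_1B/fps_coef0X.
apply: (mulrI u); rewrite qexp_convSS // IH1 IH2 -(invr_qpochS N x0).
have -> : 1 - (x ^+ 2) ^+ N.+2 = (1 + x ^+ N.+2) * (1 - x ^+ N.+2).
  by rewrite -exprM mulnC exprM; move: (x ^+ N.+2) => y; ring.
rewrite -[RHS]mulrA (invr_qpochS N.+1) // [x ^+ N.+2]exprS.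
move: (x ^+ N.+1) => y. ring.
Qed.

(** Reflects (z; p)_oo (-z; p)_oo = (z^2; p^2)_oo, a series in z^2. Here s + t = 0, so the
    recurrence links only indices of equal parity. *)
Lemma qexp_conv_opp p M : p 0%N = 0 ->
  qexp_conv p 1 (-1) M.*2 = (qpoch (p ^+ 2) M)^-1 /\
  qexp_conv p 1 (-1) M.*2.+1 = 0.
Proof.
move=> p0; have pp0 : (p ^+ 2) 0%N = 0 by apply: fps_coef0X.
elim: M => [|M [IH1 IH2]]; split.
- by rewrite qexp_conv0 qpoch0 invr1.
- by apply: (mulrI (unit_1B p0)); rewrite qexp_conv1 // mulr0 subrr.
- have u : 1 - p ^+ M.*2.+2 \is a GRing.unit by apply/unit_1B/fps_coef0X.
  rewrite doubleS; apply: (mulrI u).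
  rewrite qexp_convSS // IH1 -(invr_qpochS _ pp0) -exprM.
  have -> : (2 * M.+1 = M.*2.+2)%N by lia.
  by ring.
- have u : 1 - p ^+ M.*2.+3 \is a GRing.unit by apply/unit_1B/fps_coef0X.
  by rewrite doubleS; apply: (mulrI u); rewrite qexp_convSS // IH2; ring.
Qed.

Section Transform.
Variable x : fps K.
Hypothesis x0 : x 0%N = 0.

Let p0 : (x ^+ 2) 0%N = 0. Proof. exact: fps_coef0X. Qed.

Lemma odd_factor_eqm t n : eqm n (1 + t * x ^+ n.*2.+1) 1.
Proof. by apply/eqm_1D/eqm0Mr/eqmX0 => //; lia. Qed.

Lemma euler_term_eqm t n : eqm n (qexp (x ^+ 2) t n * x ^+ (n ^ 2)) 0.
Proof. by apply/eqm0Mr/eqmX0 => //; nia. Qed.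

Lemma euler_series_step t :
  let S t := fps_series (fun m => qexp (x ^+ 2) t m * x ^+ (m ^ 2)) in
  S t = (1 + t * x) * S (t * x ^+ 2).
Proof.
move=> S; apply: eqmP => M; have le := leqnSn M.
apply: (eqm_trans (seriesE (euler_term_eqm t) le)); apply: eqm_sym.
rewrite mulrDl mul1r.
(* The factor t x raises the index of the second series by one, so M of its terms pair with M + 1
   terms of the first. *)
apply: (eqm_trans (eqmD (seriesE (euler_term_eqm (t * x ^+ 2)) le)
  (eqmM (@eqm_refl _ _ (t * x))
        (seriesE (euler_term_eqm (t * x ^+ 2)) (leqnn M))))).
split=> n _; congr (fps_coef _ n).
rewrite !big_ord_recl !qexp0 -addrA; congr (_ + _).
rewrite mulr_sumr -big_split; apply: eq_bigr => m _ /=.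
have -> : qexp (x ^+ 2) (t * x ^+ 2) m.+1 =
    qexp (x ^+ 2) t m.+1 * x ^+ 2 ^+ m.+1.
  by rewrite /qexp exprMn; ring.
have -> : qexp (x ^+ 2) (t * x ^+ 2) m = qexp (x ^+ 2) t m * x ^+ 2 ^+ m.
  by rewrite /qexp exprMn; ring.
have e : t * x * (qexp (x ^+ 2) t m * x ^+ 2 ^+ m * x ^+ (m ^ 2)) =
    (t * qexp (x ^+ 2) t m) * x ^+ (m.+1 ^ 2).
  have -> : x ^+ (m.+1 ^ 2) = x * (x ^+ 2 ^+ m * x ^+ (m ^ 2)).
    by rewrite -exprM -exprD -exprS; congr (_ ^+ _); lia.
  by ring.
by rewrite /bump /= add1n e -qexpS //; ring.
Qed.

Lemma euler_product t :
  fps_infprod (fun j => 1 + t * x ^+ j.*2.+1) =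
  fps_series (fun m => qexp (x ^+ 2) t m * x ^+ (m ^ 2)).
Proof.
set S := fun t => fps_series (fun m => qexp (x ^+ 2) t m * x ^+ (m ^ 2)).
rewrite -/(S t); apply: eqmP => M.
have SJ J : S t = \prod_(j < J) (1 + t * x ^+ j.*2.+1) * S (t * x ^+ J.*2).
  elim: J => [|J ->]; first by rewrite big_ord0 mul1r mulr1.
  rewrite big_ord_recr /= -mulrA; congr (_ * _).
  rewrite [LHS](euler_series_step (t * x ^+ J.*2)) doubleS.
  by rewrite -!mulrA -exprSr -exprD addn2.
apply: (eqm_trans (infprodE (odd_factor_eqm t) (leqnn M))).
(* After M steps the argument is t x^(2M), at which the series is 1 modulo q^M. *)
rewrite (SJ M) -[X in eqm _ X _]mulr1; apply: eqmM => //.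
apply: eqm_sym; apply: (eqm_trans (seriesE (euler_term_eqm _) (leqnSn M))).
rewrite big_ord_recl qexp0 expr0 mulr1 -[X in eqm _ _ X]addr0.
apply: eqmD => //; apply: eqm_sum0 => m _; apply: eqm0Ml.
rewrite /= /qexp /bump /= add1n exprS; do 2! apply: eqm0Ml.
by apply/eqm0Mr/eqmX0 => //; lia.
Qed.

(** The denominator is a parameter [d], so that closed forms such as (x^4; x^4)_n or (x; x)_(2n) can
    be supplied directly. *)
Lemma transform s t (d : nat -> fps K) :
  (forall n, d n = qpoch (x ^+ 2) n * \prod_(j < n) (1 + t * x ^+ j.*2.+1)) ->
  fps_infprod (fun j => 1 + t * x ^+ j.*2.+1) *
    fps_series (fun n => x ^+ (n ^ 2) * s ^+ n / d n) =
  fps_series (fun N => x ^+ (N ^ 2) * qexp_conv (x ^+ 2) s t N).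
Proof.
move=> dE; rewrite seriesMl; last first.
  by move=> n; do 2! apply: eqm0Ml; apply: eqmX0 => //; nia.
pose c n m := x ^+ ((n + m) ^ 2) * (qexp (x ^+ 2) s n * qexp (x ^+ 2) t m).
transitivity (fps_series (fun n => fps_series (c n))).
  apply: series_eq => n.
  rewrite (infprod_split n (odd_factor_eqm t)) dE.
  have u1 : qpoch (x ^+ 2) n \is a GRing.unit by apply: unit_qpoch.
  have u2 : \prod_(j < n) (1 + t * x ^+ j.*2.+1) \is a GRing.unit.
    apply: (@unit_prod n (fun j => 1 + t * x ^+ j.*2.+1)) => j.
    by apply: unit_1D; rewrite fps_coef0M fps_coef0X // mulr0.
  move: u2; set P := \prod_(j < n) _ => u2; set A := fps_infprod _.
  have -> : P * A * (x ^+ (n ^ 2) * s ^+ n / (qpoch (x ^+ 2) n * P)) =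
      x ^+ (n ^ 2) * qexp (x ^+ 2) s n * A * (P / P).
    by rewrite invrM // /qexp; ring.
  rewrite divrr // mulr1 {u2}/A.
  (* The tail of the product is Euler's product at t x^(2n); its expansion completes the square n^2
     + 2nm + m^2 = (n + m)^2. *)
  rewrite (infprod_eq (v := fun j => 1 + (t * x ^+ n.*2) * x ^+ j.*2.+1)).
    rewrite euler_product seriesMl; last exact: euler_term_eqm.
    apply: series_eq => m; rewrite /c /qexp exprMn -exprM.
    have -> : ((n + m) ^ 2 = n ^ 2 + n.*2 * m + m ^ 2)%N by lia.
    by rewrite !exprD; ring.
  by move=> j; rewrite doubleD -addnS exprD mulrA.
rewrite series_antidiagonal => [|n m]; last first.
  by apply: eqm0Ml; apply: eqmX0 => //; nia.
apply: series_eq => N; rewrite /qexp_conv mulr_sumr.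
by apply: eq_bigr => n _; rewrite /c subnKC // -ltnS.
Qed.

End Transform.
End QSeries.

(** * Dissection *)

Section Dissection.
Variable K : fieldType.
Implicit Types s x y : fps K.

Definition rrG x : fps K := fps_series (fun k => x ^+ (k ^ 2) / qpoch x k).
Definition rrH x : fps K := fps_series (fun k => x ^+ (k * k.+1) / qpoch x k).

Definition prod1D x : fps K := fps_infprod (fun j => 1 + x ^+ j.+1).

Lemma prod1D_factor_eqm x n : x 0%N = 0 -> eqm n (1 + x ^+ n.+1) 1.
Proof. by move=> x0; apply/eqm_1D/eqmX0 => //; lia. Qed.

Lemma series0 : fps_series (fun=> 0 : fps K) = 0.
Proof.
apply: eqmP => M; have z n : eqm n (0 : fps K) 0 by [].
by apply: (eqm_trans (seriesE z (leqnn M))); rewrite big1.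
Qed.

Lemma exprN1_even (n : nat) : ~~ odd n -> (-1 : fps K) ^+ n = 1.
Proof. by move=> /negbTE en; rewrite -signr_odd en. Qed.

(* Euler's (-y; y)_oo = 1/(y; y^2)_oo. *)
Lemma prod1D_odd y : y 0%N = 0 ->
  prod1D y * fps_infprod (fun j => 1 + -1 * y ^+ j.*2.+1) = 1.
Proof.
move=> y0; have e1 n : eqm n (1 + y ^+ n.+1) 1 by apply: prod1D_factor_eqm.
have e2 n : eqm n (1 + -1 * y ^+ n.*2.+1) 1 by apply: odd_factor_eqm.
rewrite /prod1D infprodM //; apply: eqmP => M.
have e3 n : eqm n ((1 + y ^+ n.+1) * (1 + -1 * y ^+ n.*2.+1)) 1.
  by rewrite -[X in eqm _ _ X]mulr1; apply: eqmM.
apply: (eqm_trans (infprodE e3 (leqnn M))).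
(* The quotient is the product of 1 - y^i for M < i <= 2M, which is 1 modulo q^M. *)
have -> : \prod_(j < M) ((1 + y ^+ j.+1) * (1 + -1 * y ^+ j.*2.+1)) =
    qpoch y (M + M) / qpoch y M.
  apply: (canRL (mulrK (unit_qpoch M y0))); elim: M => [|M IHM].
    by rewrite big_ord0 qpoch0 mulr1.
  rewrite big_ord_recr addnS addSn !qpochS -IHM /= addnn.
  have -> : y ^+ M.*2.+2 = y ^+ M.+1 * y ^+ M.+1.
    by rewrite -exprD; congr (_ ^+ _); lia.
  by ring.
rewrite -[X in eqm _ _ X](divrr (unit_qpoch M y0)); apply: eqmM => //.
rewrite {1}/qpoch big_split_ord /= -[X in eqm _ _ X]mulr1; apply: eqmM => //.
apply: eqm_prod1 => i _; rewrite -mulN1r; apply/eqm_1D/eqm0Mr/eqmX0 => //.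
by lia.
Qed.

Lemma qpoch_sqr x n :
  qpoch (x ^+ 2) n = qpoch x n * \prod_(j < n) (1 + x ^+ j.+1).
Proof.
rewrite /qpoch -big_split; apply: eq_bigr => j _ /=.
by rewrite -exprM mulnC exprM; move: (x ^+ j.+1) => a; ring.
Qed.

Lemma qpoch_double x n :
  qpoch x n.*2 = qpoch (x ^+ 2) n * \prod_(j < n) (1 + -1 * x ^+ j.*2.+1).
Proof.
elim: n => [|n IHn]; first by rewrite /qpoch !big_ord0 mulr1.
rewrite doubleS !qpochS IHn big_ord_recr /= -[x ^+ 2 ^+ _]exprM.
have -> : (2 * n.+1 = n.*2.+2)%N by lia.
by ring.
Qed.

Lemma qpoch_double_shift x n :
  qpoch x n.*2.+1 =
  (1 - x) * (qpoch (x ^+ 2) n * \prod_(j < n) (1 + - x ^+ 2 * x ^+ j.*2.+1)).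
Proof.
rewrite qpochS qpoch_double -mulrA.
have -> : \prod_(j < n) (1 + -1 * x ^+ j.*2.+1) * (1 - x ^+ n.*2.+1) =
    (1 - x) * \prod_(j < n) (1 + - x ^+ 2 * x ^+ j.*2.+1).
  elim: n => [|n IHn]; first by rewrite !big_ord0 mul1r mulr1.
  rewrite !big_ord_recr /= mulrA -IHn doubleS mulN1r mulNr.
  by rewrite -exprD.
by ring.
Qed.

Section Base.
Variable x : fps K.
Hypothesis x0 : x 0%N = 0.

Let p0 : (x ^+ 2) 0%N = 0. Proof. exact: fps_coef0X. Qed.

Lemma prod1D_sqrE :
  fps_infprod (fun j => 1 + x * x ^+ j.*2.+1) = prod1D (x ^+ 2).
Proof.
apply: infprod_eq => j; rewrite -exprS -exprM.
by congr (_ + _ ^+ _); lia.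
Qed.

Lemma quartic_denominator n :
  qpoch (x ^+ 4) n =
  qpoch (x ^+ 2) n * \prod_(j < n) (1 + x * x ^+ j.*2.+1).
Proof.
rewrite (exprM x 2 2) qpoch_sqr; congr (_ * _); apply: eq_bigr => j _.
by rewrite -exprS -exprM; congr (_ + _ ^+ _); lia.
Qed.

Lemma rrG_quartic : rrG x =
  prod1D (x ^+ 2) * fps_series (fun n => x ^+ (n ^ 2) / qpoch (x ^+ 4) n).
Proof.
have := transform x0 1 quartic_denominator; rewrite prod1D_sqrE.
rewrite (series_eq (v := fun n => x ^+ (n ^ 2) / qpoch (x ^+ 4) n)) => [->|n].
  by apply: series_eq => N; rewrite qexp_conv_sqrt.
by rewrite expr1n mulr1.
Qed.

Lemma rrH_quartic : rrH x =
  prod1D (x ^+ 2) * fps_series (fun n => x ^+ (n ^ 2 + 2 * n) / qpoch (x ^+ 4) n).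
Proof.
have := transform x0 (x ^+ 2) quartic_denominator; rewrite prod1D_sqrE.
rewrite (series_eq (v := fun n => x ^+ (n ^ 2 + 2 * n) / qpoch (x ^+ 4) n)).
  move=> ->; apply: series_eq => N.
  have -> : qexp_conv (x ^+ 2) (x ^+ 2) x N = x ^+ N / qpoch x N.
    rewrite -qexp_conv_sqrt // qexp_convC -qexp_conv_scale mulr1.
    by congr (qexp_conv _ _ _ _); rewrite expr2.
  have -> : x ^+ (N * N.+1) = x ^+ (N ^ 2) * x ^+ N.
    by rewrite -exprD; congr (_ ^+ _); lia.
  by rewrite mulrA.
by move=> n; rewrite exprD exprM.
Qed.

Lemma odd_product_shift :
  fps_infprod (fun j => 1 + -1 * x ^+ j.*2.+1) =
  (1 - x) * fps_infprod (fun j => 1 + - x ^+ 2 * x ^+ j.*2.+1).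
Proof.
rewrite (infprod_split 1 (odd_factor_eqm x0 _)) big_ord1 mulN1r expr1.
congr (_ * _); apply: infprod_eq => j.
by rewrite mulN1r mulNr -exprD.
Qed.

Lemma series_qexp_conv_opp s :
  fps_series (fun N => x ^+ (N ^ 2) * qexp_conv (x ^+ 2) s (- s) N) =
  fps_series (fun n => x ^+ (4 * n ^ 2) * s ^+ n.*2 / qpoch (x ^+ 4) n).
Proof.
have e N : qexp_conv (x ^+ 2) s (- s) N = s ^+ N * qexp_conv (x ^+ 2) 1 (-1) N.
  by rewrite -qexp_conv_scale mulr1 mulrN1.
rewrite series_even_odd; last by move=> N; apply/eqm0Ml/eqmX0 => //; nia.
rewrite [X in _ + X](series_eq (v := fun=> 0)) => [|n]; last first.
  by rewrite e (qexp_conv_opp n p0).2 !mulr0.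
rewrite series0 addr0; apply: series_eq => n.
rewrite e (qexp_conv_opp n p0).1 -exprM mulrA.
by congr (_ ^+ _ * _ / _); lia.
Qed.

Lemma even_denominator_transform s :
  fps_series (fun n => x ^+ (n ^ 2) * s ^+ n / qpoch x n.*2) =
  prod1D x * fps_series (fun N => x ^+ (N ^ 2) * qexp_conv (x ^+ 2) s (-1) N).
Proof.
by rewrite -(transform x0 s (qpoch_double x)) mulrA prod1D_odd // mul1r.
Qed.

(** Up to the factor 1 - x, (x; x)_(2n+1) is the denominator of [transform] for t = -x^2. The same
    factor completes (x^3; x^2)_oo to (x; x^2)_oo, whose inverse is [prod1D x]. *)
Lemma odd_denominator_transform s :
  fps_series (fun n => x ^+ (n ^ 2) * s ^+ n / qpoch x n.*2.+1) =
  prod1D x *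
    fps_series (fun N => x ^+ (N ^ 2) * qexp_conv (x ^+ 2) s (- x ^+ 2) N).
Proof.
pose d n := qpoch (x ^+ 2) n * \prod_(j < n) (1 + - x ^+ 2 * x ^+ j.*2.+1).
rewrite -(@transform _ x x0 s _ d) //; set A := fps_infprod _.
have e0 n : eqm n (x ^+ (n ^ 2) * s ^+ n / qpoch x n.*2.+1) 0.
  by do 2! apply: eqm0Ml; apply: eqmX0 => //; nia.
have -> : fps_series (fun n => x ^+ (n ^ 2) * s ^+ n / d n) =
    (1 - x) * fps_series (fun n => x ^+ (n ^ 2) * s ^+ n / qpoch x n.*2.+1).
  rewrite seriesMl //; apply: series_eq => n.
  have u1 : 1 - x \is a GRing.unit by apply: unit_1B.
  have ud : d n \is a GRing.unit.
    have := unit_qpoch n.*2.+1 x0.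
    by rewrite qpoch_double_shift unitrM u1.
  rewrite qpoch_double_shift -/(d n) (invrM u1 ud).
  transitivity (x ^+ (n ^ 2) * s ^+ n / d n * ((1 - x) / (1 - x))); last by ring.
  by rewrite divrr // mulr1.
have := prod1D_odd x0; rewrite odd_product_shift -/A => e.
by rewrite mulrA mulrA -[_ * A * _]mulrA [A * _]mulrC e mul1r.
Qed.

End Base.

Section EvenOdd.
Variable y : fps K.
Hypothesis y0 : y 0%N = 0.

Lemma slater_G4 :
  fps_series (fun n => y ^+ (n ^ 2) / qpoch y n.*2) = prod1D y * rrG (y ^+ 4).
Proof.
rewrite (series_eq (v := fun n => y ^+ (n ^ 2) * 1 ^+ n / qpoch y n.*2)).
  rewrite even_denominator_transform // series_qexp_conv_opp //.
  congr (_ * _); apply: series_eq => n.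
  by rewrite expr1n mulr1 exprM.
by move=> n; rewrite expr1n mulr1.
Qed.

Lemma slater_H4 :
  fps_series (fun n => y ^+ (n ^ 2 + 2 * n) / qpoch y n.*2.+1) =
  prod1D y * rrH (y ^+ 4).
Proof.
rewrite (series_eq
  (v := fun n => y ^+ (n ^ 2) * (y ^+ 2) ^+ n / qpoch y n.*2.+1)).
  rewrite odd_denominator_transform // series_qexp_conv_opp //.
  congr (_ * _); apply: series_eq => n.
  rewrite -!exprM -exprD; congr (_ ^+ _ / _); lia.
by move=> n; rewrite exprD exprM.
Qed.

(** The base y^2 has the second square root -y, which is how G and H at a negated argument arise. *)
Lemma qexp_conv_sqrtN a N :
  qexp_conv (y ^+ 2) a (a * - y) N = a ^+ N / qpoch (- y) N.
Proof.
rewrite -{1}[a]mulr1 qexp_conv_scale -[y ^+ 2]sqrrN qexp_conv_sqrt //.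
exact: fps_coef0N.
Qed.

Lemma slater_HN :
  fps_series (fun n => y ^+ (n ^ 2 + n) / qpoch y n.*2.+1) =
  prod1D y * rrH (- y).
Proof.
rewrite (series_eq (v := fun n => y ^+ (n ^ 2) * y ^+ n / qpoch y n.*2.+1)).
  rewrite odd_denominator_transform //.
  congr (_ * _); apply: series_eq => n.
  have -> : - y ^+ 2 = y * - y by ring.
  rewrite qexp_conv_sqrtN mulrA -exprD.
  congr (_ / _); rewrite [in RHS]exprNn exprN1_even ?mul1r; last by rewrite oddM /= andbN.
  by congr (_ ^+ _); lia.
by move=> n; rewrite exprD.
Qed.

Lemma slater_GN :
  fps_series (fun n => y ^+ (n ^ 2 + n) / qpoch y n.*2) =
  prod1D y * rrG (- y).
Proof.
rewrite (series_eq (v := fun n => y ^+ (n ^ 2) * y ^+ n / qpoch y n.*2)).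
  rewrite even_denominator_transform //.
  congr (_ * _); apply: series_eq => n.
  have -> : qexp_conv (y ^+ 2) y (-1) n = (-1) ^+ n / qpoch (- y) n.
    by rewrite -qexp_conv_sqrtN mulrNN mul1r qexp_convC.
  rewrite mulrA; congr (_ / _).
  rewrite [in RHS]exprNn mulrC; congr (_ * _).
  (* The signs agree because n^2 and n have the same parity. *)
  by rewrite -signr_odd -[RHS]signr_odd oddX.
by move=> n; rewrite exprD.
Qed.

End EvenOdd.

Definition rrF x := prod1D (x ^+ 2) * prod1D (x ^+ 4).

(** With y = x^4, the exponent n^2 equals 4 m^2 for n = 2m and 1 + 4 (m^2 + m) for n = 2m + 1, so
    the two halves are [slater_G4] and [slater_HN]. *)
Lemma rrG_dissection x : x 0%N = 0 ->
  rrG x = rrF x * (rrG (x ^+ 16) + x * rrH (- x ^+ 4)).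
Proof.
move=> x0; have y0 : (x ^+ 4) 0%N = 0 by apply: fps_coef0X.
rewrite rrG_quartic // /rrF series_even_odd => [|n]; last first.
  by apply/eqm0Ml/eqmX0 => //; nia.
rewrite -mulrA; congr (_ * _).
rewrite (exprM x 4 4) mulrDr -(slater_G4 y0) mulrCA -(slater_HN y0).
rewrite seriesMl => [|n]; last by apply/eqm0Ml/eqmX0 => //; nia.
congr (_ + _); apply: series_eq => n.
  by rewrite -exprM; congr (_ ^+ _ / _); lia.
by rewrite mulrA -exprM -exprS; congr (_ ^+ _ / _); lia.
Qed.

(** The exponent n^2 + 2n equals 4 (m^2 + m) for n = 2m and 3 + 4 (m^2 + 2m) for n = 2m + 1,
    matching [slater_GN] and [slater_H4]. *)
Lemma rrH_dissection x : x 0%N = 0 ->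
  rrH x = rrF x * (rrG (- x ^+ 4) + x ^+ 3 * rrH (x ^+ 16)).
Proof.
move=> x0; have y0 : (x ^+ 4) 0%N = 0 by apply: fps_coef0X.
rewrite rrH_quartic // /rrF series_even_odd => [|n]; last first.
  by apply/eqm0Ml/eqmX0 => //; nia.
rewrite -mulrA; congr (_ * _).
rewrite (exprM x 4 4) mulrDr -(slater_GN y0) mulrCA -(slater_H4 y0).
rewrite seriesMl => [|n]; last by apply/eqm0Ml/eqmX0 => //; nia.
congr (_ + _); apply: series_eq => n.
  by rewrite -exprM; congr (_ ^+ _ / _); lia.
by rewrite mulrA -exprM -exprD; congr (_ ^+ _ / _); lia.
Qed.

End Dissection.

(** * Substitution *)

Section Composition.
Variables (K : fieldType) (r : fps K).
Hypothesis r0 : r 0%N = 0.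
Implicit Types f g : fps K.

Lemma comp_term_eqm f n : eqm n (f n *: r ^+ n) 0.
Proof.
by rewrite -[X in eqm _ _ X](scaler0 _ (f n)); apply/eqmZ/eqmX0.
Qed.

Lemma fps_compE f M m : (M <= m)%N ->
  eqm M (f \oq r) (\sum_(k < m) f k *: r ^+ k).
Proof. exact: (seriesE (comp_term_eqm f)). Qed.

Lemma fps_comp_coef0 f : (f \oq r) 0%N = f 0%N.
Proof.
rewrite (eqm_coef (fps_compE f (leqnn 1)) (ltn0Sn 0)) big_ord1 expr0 /=.
by rewrite mulr1.
Qed.

Lemma fps_comp_congr M f g : eqm M f g -> eqm M (f \oq r) (g \oq r).
Proof.
move=> [e]; apply: (eqm_trans (fps_compE f (leqnn M))); apply: eqm_sym.
apply: (eqm_trans (fps_compE g (leqnn M))); split=> n _.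
by congr (fps_coef _ n); apply: eq_bigr => k _; rewrite e.
Qed.

(** The order of vanishing at least doubles, and 2M >= M + 1 for positive M. *)
Lemma fps_comp_eqm0 M f : (0 < M)%N -> eqm 2 r 0 -> eqm M f 0 ->
  eqm M.+1 (f \oq r) 0.
Proof.
move=> M0 r2 [f0]; apply: (eqm_trans (fps_compE f (leqnn M.+1))).
apply: eqm_sum0 => k _; have [ltk|lek] := ltnP k M.
  by rewrite f0 //= scale0r.
rewrite -[X in eqm _ _ X](scaler0 _ (f k)); apply: eqmZ.
by apply: eqm_leq (eqm0X k r2) _; lia.
Qed.

Lemma fps_compD f g : (f + g) \oq r = f \oq r + g \oq r.
Proof.
apply: eqmP => M; have le := leqnn M.
apply: (eqm_trans (fps_compE _ le)); apply: eqm_sym.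
apply: (eqm_trans (eqmD (fps_compE f le) (fps_compE g le))).
rewrite -big_split; split=> n _; congr (fps_coef _ n); apply: eq_bigr => k _.
by rewrite /= scalerDl.
Qed.

Lemma fps_compZ c f : (c *: f) \oq r = c *: (f \oq r).
Proof.
apply: eqmP => M; have le := leqnn M.
apply: (eqm_trans (fps_compE _ le)); apply: eqm_sym.
apply: (eqm_trans (eqmZ c (fps_compE f le))).
rewrite scaler_sumr; split=> n _; congr (fps_coef _ n); apply: eq_bigr => k _.
by rewrite /= scalerA.
Qed.

Lemma fps_compB f g : (f - g) \oq r = f \oq r - g \oq r.
Proof. by rewrite -scaleN1r fps_compD fps_compZ scaleN1r. Qed.

Lemma fps_comp1 : 1 \oq r = 1.
Proof.
apply: eqmP => M; apply: (eqm_trans (fps_compE _ (leqnSn M))).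
rewrite big_ord_recl expr0 /= scale1r -[X in eqm _ _ X]addr0.
by apply: eqmD => //; apply: eqm_sum0 => k _; rewrite scale0r.
Qed.

Lemma fps_compX : fps_X \oq r = r.
Proof.
apply: eqmP => M; have le : (M <= M.+2)%N by lia.
apply: (eqm_trans (fps_compE _ le)).
rewrite !big_ord_recl expr0 expr1 /= scale0r scale1r add0r -[X in eqm _ _ X]addr0.
by apply: eqmD => //; apply: eqm_sum0 => k _; rewrite scale0r.
Qed.

Lemma horner_alg_sum (p : {poly K}) m : (size p <= m)%N ->
  horner_alg r p = \sum_(k < m) p`_k *: r ^+ k.
Proof.
move=> lem; rewrite /horner_alg /horner_morph (@horner_coef_wide _ m).
  by apply: eq_bigr => k _; rewrite coef_map mulr_algl.
exact: leq_trans (size_poly _ _) lem.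
Qed.

Lemma fps_comp_trunc M f : eqm M (f \oq r) (horner_alg r (fps_trunc M f)).
Proof.
apply: (eqm_trans (fps_compE f (leqnn M))).
rewrite (horner_alg_sum (size_poly _ _)); split=> n _; congr (fps_coef _ n).
by apply: eq_bigr => k _; rewrite coef_poly ltn_ord.
Qed.

Lemma horner_alg_congr M (p p' : {poly K}) :
  (forall k, (k < M)%N -> p`_k = p'`_k) ->
  eqm M (horner_alg r p) (horner_alg r p').
Proof.
move=> e; set m := maxn M (maxn (size p) (size p')).
rewrite !(@horner_alg_sum _ m); try lia.
apply: eqm_sum => k _; have [ltk|lek] := ltnP k M; first by rewrite e.
have z c : eqm M (c *: r ^+ k) 0.
  by rewrite -[X in eqm _ _ X](scaler0 _ c); apply/eqmZ/eqmX0.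
exact: eqm_trans (z _) (eqm_sym (z _)).
Qed.

(** Modulo q^M, substitution is evaluation of a truncated polynomial at r, which is a ring morphism;
    coefficients of index M or more contribute only multiples of q^M. *)
Lemma fps_compM f g : (f * g) \oq r = (f \oq r) * (g \oq r).
Proof.
apply: eqmP => M; apply: (eqm_trans (fps_comp_trunc M _)); apply: eqm_sym.
apply: (eqm_trans (eqmM (fps_comp_trunc M f) (fps_comp_trunc M g))).
rewrite -rmorphM; apply: horner_alg_congr => k ltk.
by rewrite [RHS]coef_poly ltk; symmetry; apply: fps_mul_trunc.
Qed.

Lemma fps_comp_exp f n : (f ^+ n) \oq r = (f \oq r) ^+ n.
Proof.
elim: n => [|n IHn]; first by rewrite !expr0 fps_comp1.
by rewrite !exprS fps_compM IHn.
Qed.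

Lemma fps_compV f : f \is a GRing.unit -> f^-1 \oq r = (f \oq r)^-1.
Proof.
move=> uf; have e : (f \oq r) * (f^-1 \oq r) = 1.
  by rewrite -fps_compM divrr // fps_comp1.
have u : f \oq r \is a GRing.unit by apply/unitrPr; exists (f^-1 \oq r).
by apply: (mulrI u); rewrite e divrr.
Qed.

Lemma fps_comp_qpoch x n : qpoch x n \oq r = qpoch (x \oq r) n.
Proof.
elim: n => [|n IHn]; first by rewrite !qpoch0 fps_comp1.
by rewrite !qpochS fps_compM IHn fps_compB fps_comp1 fps_comp_exp.
Qed.

Lemma fps_comp_series (u : nat -> fps K) : (forall n, eqm n (u n) 0) ->
  fps_series u \oq r = fps_series (fun n => u n \oq r).
Proof.
move=> u0; apply: eqmP => M; have le := leqnn M.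
have zr : 0 \oq r = 0 by rewrite -(subrr 1) fps_compB !subrr.
have ur0 n : eqm n (u n \oq r) 0.
  by rewrite -[X in eqm _ _ X]zr; apply: fps_comp_congr.
apply: (eqm_trans (fps_comp_congr (seriesE u0 le))).
apply: eqm_sym; apply: (eqm_trans (seriesE ur0 le)); split=> n _.
by rewrite (big_morph _ fps_compD zr).
Qed.

Lemma rrG_comp : rrG fps_X \oq r = rrG r.
Proof.
rewrite fps_comp_series => [|n]; last by apply/eqm0Ml/eqmX0 => //; nia.
apply: series_eq => n; rewrite fps_compM fps_compV ?unit_qpoch //.
by rewrite fps_comp_exp fps_comp_qpoch fps_compX.
Qed.

Lemma rrH_comp : rrH fps_X \oq r = rrH r.
Proof.
rewrite fps_comp_series => [|n]; last by apply/eqm0Ml/eqmX0 => //; nia.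
apply: series_eq => n; rewrite fps_compM fps_compV ?unit_qpoch //.
by rewrite fps_comp_exp fps_comp_qpoch fps_compX.
Qed.

End Composition.

(** * The functional system *)

Section System.
Variable K : fieldType.
Local Notation q := (@fps_X K).
Implicit Types g h : fps K.

Lemma RR_GE : RR_G = rrG q.
Proof. by apply: series_eq => n; rewrite big_add1 /= big_mkord. Qed.

Lemma RR_HE : RR_H = rrH q.
Proof. by apply: series_eq => n; rewrite big_add1 /= big_mkord. Qed.

(** Factor by factor, (1 - a^4)/(1 - a) = (1 + a)(1 + a^2) with a = q^(2j+2). *)
Lemma RR_FE : RR_F = rrF q.
Proof.
have q0 m : (q ^+ m.+1) 0%N = 0 by apply: fps_coef0X.
rewrite /rrF /prod1D infprodM; try by move=> n; apply: prod1D_factor_eqm.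
apply: infprod_eq => j.
have u : 1 - q ^+ (2 * j + 2) \is a GRing.unit.
  by apply: unit_1B; rewrite addn2.
apply: (mulIr u); rewrite mulrVK //.
have -> : q ^+ (8 * j + 8) = (q ^+ (2 * j + 2)) ^+ 4.
  by rewrite -exprM; congr (_ ^+ _); lia.
have -> : q ^+ 2 ^+ j.+1 = q ^+ (2 * j + 2).
  by rewrite -exprM; congr (_ ^+ _); lia.
have -> : q ^+ 4 ^+ j.+1 = (q ^+ (2 * j + 2)) ^+ 2.
  by rewrite -!exprM; congr (_ ^+ _); lia.
by move: (q ^+ _) => a; ring.
Qed.

(** Replacing q by -q in the dissections fixes F and the series at q^16 and -q^4, and only changes
    the signs of q and q^3; sums and differences give the system. *)
Lemma RR_system_GH : RR_system (@RR_G K) RR_H.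
Proof.
have q0 m : (q ^+ m.+1) 0%N = 0 by apply: fps_coef0X.
have N0 (f : fps K) : f 0%N = 0 -> (- f) 0%N = 0 by apply: fps_coef0N.
rewrite /RR_system RR_GE RR_HE RR_FE !rrG_comp ?rrH_comp ?N0 //.
have qN n : ~~ odd n -> (- q) ^+ n = q ^+ n.
  by move=> en; rewrite exprNn exprN1_even ?mul1r.
rewrite (@rrG_dissection _ q) // (@rrH_dissection _ q) //.
rewrite (@rrG_dissection _ (- q)) ?N0 // (@rrH_dissection _ (- q)) ?N0 //.
rewrite /rrF (qN 2) // (qN 4) // (qN 16) // -/(rrF q).
have -> : (- q) ^+ 3 = - q ^+ 3 by rewrite exprNn -signr_odd expr1 mulN1r.
move: (rrG _) (rrG (- _)) (rrH _) (rrH (- _)) (rrF q) (q ^+ 3) => a b c d e f.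
move: q => x; by split; ring.
Qed.

Lemma RR_system_halved g h : (2 : K) != 0 -> RR_system g h ->
  g = RR_F * (g \oq (q ^+ 16) + q * h \oq (- q ^+ 4)) /\
  h = RR_F * (g \oq (- q ^+ 4) + q ^+ 3 * h \oq (q ^+ 16)).
Proof.
move=> n2 [e1 e2 e3 e4].
have inj : injective (fun f : fps K => 2 * f).
  move=> f f' /=; rewrite !mulr_natl => e; apply: fpsP => n.
  have := congr1 (fun a => fps_coef a n) e.
  rewrite !mulr2n /= -!mulr2n -[_ *+ 2]mulr_natl -[RHS]mulr_natl.
  exact: mulfI.
split; apply: inj.
  transitivity ((g + g \oq (- q)) + (g - g \oq (- q))); first by ring.
  by rewrite e1 e2; move: (g \oq _) (h \oq _) => a b; ring.
transitivity ((h + h \oq (- q)) + (h - h \oq (- q))); first by ring.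
by rewrite e3 e4; move: (g \oq _) (h \oq _) => a b; ring.
Qed.

Lemma RR_G_coef0 : (RR_G : fps K) 0%N = 1.
Proof.
have u0 n : eqm n (q ^+ (n ^ 2) / qpoch q n) 0.
  by apply/eqm0Ml/eqmX0 => //; nia.
rewrite RR_GE (eqm_coef (seriesE u0 (leqnn 1)) (ltn0Sn 0)) big_ord1.
by rewrite qpoch0 divr1.
Qed.

Lemma RR_system_unique g h : (2 : K) != 0 -> RR_system g h ->
  g = g 0%N *: RR_G /\ h = g 0%N *: RR_H.
Proof.
move=> n2 gh; have [eG eH] := RR_system_halved n2 RR_system_GH.
have [eg eh] := RR_system_halved n2 gh.
pose c := g 0%N; pose d := g - c *: RR_G; pose e := h - c *: RR_H.
have r0 : (q ^+ 16) 0%N = 0 by apply: fps_coef0X.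
have r1 : (- q ^+ 4) 0%N = 0 by apply/fps_coef0N/fps_coef0X.
have lin (f u v w u' v' : fps K) :
    f * (u + w * v) - c *: (f * (u' + w * v')) =
    f * ((u - c *: u') + w * (v - c *: v')).
  rewrite scalerAr scalerDr scalerAr.
  by move: (_ *: u') (_ *: v') => a b; ring.
have dE : d = RR_F * (d \oq (q ^+ 16) + q * e \oq (- q ^+ 4)).
  by rewrite !fps_compB // !fps_compZ // -lin -eg -eG.
have eE : e = RR_F * (d \oq (- q ^+ 4) + q ^+ 3 * e \oq (q ^+ 16)).
  by rewrite !fps_compB // !fps_compZ // -lin -eh -eH.
have s1 : eqm 2 (q ^+ 16) 0 by apply: eqmX0.
have s2 : eqm 2 (- q ^+ 4) 0 by rewrite -mulN1r; apply/eqm0Mr/eqmX0.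
have d0 : d 0%N = 0 by rewrite /= RR_G_coef0 mulr1 subrr.
(* The constant term of the second series is forced by that of the first, so one constant c serves
   both. *)
have e0 : e 0%N = 0.
  have coefD (f f' : fps K) : (f + f') 0%N = f 0%N + f' 0%N by [].
  rewrite eE fps_coef0M coefD (fps_coef0M (q ^+ 3)) fps_comp_coef0 // d0.
  by rewrite fps_coef0X // mul0r addr0 mulr0.
(* Each pass through the system gains one order for both differences at once. *)
have z M : eqm M.+1 d 0 /\ eqm M.+1 e 0.
  elim: M => [|M [zd ze]]; first by split; split=> -[].
  split; [rewrite dE | rewrite eE]; apply: eqm0Mr;
    rewrite -[X in eqm _ _ X]addr0; apply: eqmD; try apply: eqm0Mr;
    exact: fps_comp_eqm0.
split; apply/eqP; rewrite -subr_eq0; apply/eqP/eqmP => M.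
  by apply: eqm_leq (z M).1 _.
by apply: eqm_leq (z M).2 _.
Qed.

End System.

Theorem mainTheorem1 (R : realType) :
  [/\ RR_system (@RR_G R[i]) RR_H,
      forall g h : fps R[i], RR_system g h ->
        exists c : R[i], g = c *: RR_G /\ h = c *: RR_H
    & forall g h : fps R[i], RR_system g h ->
        g 0%N = 1 -> h 0%N = 1 -> g = RR_G /\ h = RR_H].
Proof.
have n2 : (2 : R[i]) != 0 by rewrite Num.Theory.pnatr_eq0.
split=> [|g h gh|g h gh g0 _].
- exact: RR_system_GH.
- by exists (g 0%N); apply: RR_system_unique.
have [eg eh] := RR_system_unique n2 gh.
by split; [rewrite eg g0; exact: scale1r | rewrite eh g0; exact: scale1r].
Qed.
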